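(* With $\sigma_k$ the $k$-th elementary symmetric polynomial of the four variables $a,b,c,d$, for $t\in\mathbb{R}$ let $$\mathfrak{g}_t=\tfrac13\Big(3\sigma_1^4-2(t+7)\sigma_1^2\sigma_2+(t+3)^2\sigma_2^2-2(t^2-9)\sigma_1\sigma_3-4(t+3)^2\sigma_4\Big),$$ $$\mathfrak{f}_t^{ab}=\tfrac13\Big(3\sigma_1^4-2(t+7)\sigma_1^2\sigma_2+8(t+1)\sigma_2^2+(t^2-6t+21)\sigma_1\sigma_3-16(t^2+3)\sigma_4\Big),$$ $$\mathfrak{f}_t^{c}=\tfrac19\Big(9\sigma_1^4-6(t+7)\sigma_1^2\sigma_2+(t+7)^2\sigma_2^2+12(t-1)\sigma_1\sigma_3-12(t-1)(3t+13)\sigma_4\Big).$$ (1) If $t\ne-3$, then $\mathfrak{g}_t$ is irreducible in $\mathbb{C}[a,b,c,d]$. (2) If $0\le t\le5$, then $\mathfrak{f}_t^{ab}$ is irreducible in $\mathbb{C}[a,b,c,d]$. (3) If $t>5$, then $\mathfrak{f}_t^{c}$ is irreducible in $\mathbb{C}[a,b,c,d]$. *)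

(* Defs.v *)
From mathcomp Require Import all_boot all_order all_algebra.
From mathcomp Require Import complex reals.
From mathcomp Require Import mpoly.

Set Implicit Arguments.
Unset Strict Implicit.
Unset Printing Implicit Defensive.

Import Order.TTheory GRing.Theory Num.Theory.

Local Open Scope ring_scope.
Local Open Scope complex_scope.

(* Over a field K, the units of {mpoly K[n]} are the nonzero constants. *)
Definition irreducible (A : idomainType) (p : A) : Prop :=
  [/\ p != 0, p \isn't a GRing.unit &
      forall q r : A, p = q * r -> q \is a GRing.unit \/ r \is a GRing.unit].

Section QuarticForms.

Variables (R : realType) (t : R).

(* The variables a, b, c, d are 'X_0, 'X_1, 'X_2, 'X_3. *)
Local Notation Cabcd := {mpoly R[i][4]}.
Local Notation "''s_' k" := (mesym 4 R[i] k : Cabcd)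
  (at level 8, k at level 2, format "''s_' k").
Local Notation "x %:K" := ((x : R)%:C%:MP : Cabcd)
  (at level 2, left associativity, format "x %:K").

Definition g : Cabcd :=
  (3^-1)%:K *
    (3%:K * 's_1 ^+ 4
     - (2 * (t + 7))%:K * 's_1 ^+ 2 * 's_2
     + ((t + 3) ^+ 2)%:K * 's_2 ^+ 2
     - (2 * (t ^+ 2 - 9))%:K * 's_1 * 's_3
     - (4 * (t + 3) ^+ 2)%:K * 's_4).

Definition f_ab : Cabcd :=
  (3^-1)%:K *
    (3%:K * 's_1 ^+ 4
     - (2 * (t + 7))%:K * 's_1 ^+ 2 * 's_2
     + (8 * (t + 1))%:K * 's_2 ^+ 2
     + (t ^+ 2 - 6 * t + 21)%:K * 's_1 * 's_3
     - (16 * (t ^+ 2 + 3))%:K * 's_4).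

Definition f_c : Cabcd :=
  (9^-1)%:K *
    (9%:K * 's_1 ^+ 4
     - (6 * (t + 7))%:K * 's_1 ^+ 2 * 's_2
     + ((t + 7) ^+ 2)%:K * 's_2 ^+ 2
     + (12 * (t - 1))%:K * 's_1 * 's_3
     - (12 * (t - 1) * (3 * t + 13))%:K * 's_4).

End QuarticForms.

(* Main.v *)
Require Import Defs.
From mathcomp Require Import all_boot all_order all_algebra.
From mathcomp Require Import complex reals ring lra.
From mathcomp Require Import mpoly.
Local Open Scope ring_scope.

Set Implicit Arguments.
Unset Strict Implicit.
Unset Printing Implicit Defensive.

Import Order.TTheory GRing.Theory Num.Theory.

(** Each of the three quartics has the shape
      F = s1 * G + al * s2 ^ 2 - be * s4
    with G a cubic form. Such an F is irreducible, over any field of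
    characteristic other than 2, as soon as al, be and be + 12 al are nonzero
    ([irreducible_quartic_form]); for the quartics at hand be + 12 al is a
    nonzero multiple of (t + 3) ^ 2.

    The first idea is to restrict F to the hyperplane s1 = 0, where only
    al * s2 ^ 2 - be * s4 survives. This restriction has a large symmetry
    group, that of a polynomial in the squares of the pair sums a + b, a + c,
    b + c. In particular, on the affine plane
      (a, b, c, d) = (u - 1, 1 + v, 1 - v, - u - 1)
    it is even in u and in v:
      al u^4 + ((2 al - be) v^2 + 4 al + be) u^2
        + (al v^4 + (4 al + be) v^2 + 4 al - be).
    A biquadratic polynomial A u^4 + B u^2 + C over a domain has a nontrivial
    factorization only if its discriminant B^2 - 4 A C or the product A C is a
    square in the domain ([biquadratic_factor]). Here the domain is K[v], and
      A C           = al (al v^4 + (4 al + be) v^2 + 4 al - be),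
      B^2 - 4 A C   = be ((be - 4 al) v^4 - 2 (4 al + be) v^2 + be + 12 al)
    are biquadratic once more; neither is a square because, as quadratics in
    v^2, their discriminants al^2 be (be + 12 al) and 256 al^2 be^2 do not
    vanish ([sqr_biquadratic]).

    The second idea is that nothing is lost by restricting to this plane. The
    substitution does not increase degrees, and the image of F still has
    degree 4 in u; since degrees add up in a product, each factor of F keeps
    its degree as well. Hence a nonconstant factor of F has an image that is
    nonconstant in u ([irreducible_of_specialization]). *)

(** * Biquadratic polynomials over a domain *)

Lemma coef_biquadratic (A : comNzRingType) (a b c : A) (i : nat) :
  (a%:P * 'X^4 + b%:P * 'X^2 + c%:P)`_i =
  if i == 4 then a else if i == 2 then b else if i == 0 then c else 0.
Proof.
rewrite !coefD !coefCM !coefXn coefC.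
by case: i => [|[|[|[|[|i]]]]] /=; rewrite ?mulr0 ?mulr1 ?addr0 ?add0r.
Qed.

Lemma size_biquadratic_le (A : comNzRingType) (a b c : A) :
  (size (a%:P * 'X^4 + b%:P * 'X^2 + c%:P)%R <= 5)%N.
Proof.
by apply/leq_sizeP => -[|[|[|[|[|j]]]]] //= _; rewrite coef_biquadratic.
Qed.

Lemma size_biquadratic (A : comNzRingType) (a b c : A) :
  a != 0 -> size (a%:P * 'X^4 + b%:P * 'X^2 + c%:P) = 5%N.
Proof.
move=> a0; apply/eqP; rewrite eqn_leq size_biquadratic_le /=.
rewrite ltnNge; apply: contra_neqN a0 => /leq_sizeP/(_ 4%N isT).
by rewrite coef_biquadratic.
Qed.

(** Comparing coefficients exhibits the square root in each case. If one
    factor is linear, so that e.g. a monic polynomial has a root x, then so is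
    - x, and x ^ 2 is a root of a T^2 + b T + c: the discriminant is a square.
    If both factors are quadratic, either their linear terms vanish and the
    quadratic a T^2 + b T + c itself splits, or they are exchanged up to a
    scalar by 'X |-> - 'X and a * c is a square. *)
Lemma biquadratic_factor (A : idomainType) (a b c : A) (q r : {poly A}) :
  a != 0 ->
  a%:P * 'X^4 + b%:P * 'X^2 + c%:P = q * r ->
  (1 < size q)%N -> (1 < size r)%N ->
  exists e, e ^+ 2 = b ^+ 2 - 4 * a * c \/ e ^+ 2 = a * c.
Proof.
move=> a0.
wlog le_qr : q r / (size q <= size r)%N.
  move=> H Eqr hq hr; have [le|/ltnW le] := leqP (size q) (size r).
    exact: H Eqr hq hr.
  by apply: (H r q) => //; rewrite (mulrC r).
move=> Eqr hq hr.
have szqr : (size q + size r).-1 = 5%N.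
  by rewrite -size_mul -?Eqr ?size_biquadratic // -size_poly_gt0 ltnW.
have cE i := coef_biquadratic a b c i.
move: (cE 4%N) (cE 3%N) (cE 2%N) (cE 1%N) (cE 0%N).
rewrite Eqr !coefM !big_ord_recr !big_ord0 /= !add0r => {cE}.
have qz i : (size q <= i)%N -> q`_i = 0 by move=> ?; rewrite nth_default.
have rz i : (size r <= i)%N -> r`_i = 0 by move=> ?; rewrite nth_default.
have [/eqP szq|szq] := boolP (size q == 2%N).
  rewrite (qz 2%N) ?(qz 3%N) ?(qz 4%N) ?(rz 4%N) ?szq //; last first.
    by move: szqr; rewrite szq; case: (size r) => [|[|[|[|[|?]]]]].
  rewrite !mul0r !addr0 !mulr0 !add0r.
  move: q`_0 q`_1 r`_0 r`_1 r`_2 r`_3 => e l s p n m <- h3 <- h1 <-.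
  exists (l * p - e * n); left.
  have em : e * m = - (l * n) by apply/eqP; rewrite -addr_eq0 h3.
  have ls : l * s = - (e * p) by apply/eqP; rewrite -addr_eq0 addrC h1.
  have -> : 4 * (l * m) * (e * s) = 4 * ((e * m) * (l * s)) by ring.
  by rewrite em ls; ring.
have [szq3 szr3] : size q = 3%N /\ size r = 3%N.
  move: hq le_qr szqr szq.
  case: (size q) => [|[|[|[|k]]]] //=; case: (size r) => [|[|[|[|j]]]] //=.
  by rewrite !addSn !addnS.
rewrite (qz 4%N) ?(qz 3%N) ?(rz 4%N) ?(rz 3%N) ?szq3 ?szr3 //.
rewrite !mul0r !addr0 !mulr0 !add0r.
move: q`_0 q`_1 q`_2 r`_0 r`_1 r`_2 => q0 p l r0 p' m Ea h3 <- h1 <-.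
(* The vanishing coefficients of 'X^3 and 'X combine to eliminate p'. *)
have : p * (l * r0 - m * q0) = 0.
  have e1 : p' * l = - (p * m).
    by apply/eqP; rewrite -addr_eq0 -h3; apply/eqP; ring.
  have -> : p * (l * r0 - m * q0)
    = (q0 * p' + p * r0) * l - q0 * (p' * l + p * m) by ring.
  by rewrite h1 e1 addNr mul0r mulr0 subr0.
move/eqP; rewrite mulf_eq0 => /orP[/eqP p0|/eqP].
  have p'0 : p' = 0.
    move: h3; rewrite p0 mul0r add0r => /eqP.
    rewrite mulf_eq0 => /orP[] /eqP // l0.
    by move: a0; rewrite -Ea l0 mul0r eqxx.
  by exists (l * r0 - m * q0); left; rewrite p0 -Ea; ring.
move/eqP; rewrite subr_eq0 => /eqP e1.
by exists (m * q0); right; rewrite expr2 -{1}e1 -Ea; ring.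
Qed.

(** Away from characteristic 2, the missing odd terms force a square root
    l 'X^2 + m 'X + n to have m = 0 or l = n = 0, and the hypothesis on a and
    c excludes the second possibility, which is that of (m 'X) ^ 2. *)
Lemma sqr_biquadratic (K : idomainType) (a b c : K) (w : {poly K}) :
  (2 : K) != 0 -> (a != 0) || (c != 0) ->
  w ^+ 2 = a%:P * 'X^4 + b%:P * 'X^2 + c%:P -> b ^+ 2 = 4 * a * c.
Proof.
move=> two0 ac0 Ew.
have w3 : (size w <= 3)%N.
  have [->|w0] := eqVneq w 0; first by rewrite size_poly0.
  have: (size (w ^+ 2) <= 5)%N by rewrite Ew size_biquadratic_le.
  rewrite expr2 size_mul //; case: (size w) => [|[|[|[|k]]]] //.
  by rewrite addnS /= addSnnS !addnS.
have cE i := coef_biquadratic a b c i.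
move: (cE 4%N) (cE 3%N) (cE 2%N) (cE 1%N) (cE 0%N).
rewrite -Ew expr2 !coefM !big_ord_recr !big_ord0 /= !add0r => {cE}.
rewrite (nth_default 0 w3) (@nth_default _ 0 w 4) ?(leqW w3) //.
rewrite !mul0r !addr0 !mulr0 !add0r.
move: w`_0 w`_1 w`_2 ac0 => n m l ac0 Ea h3 <- h1 Ec.
have dbl (x : K) : x + x = 0 -> x = 0.
  move=> xx0; apply/eqP.
  have: 2 * x == 0 by apply/eqP; rewrite -[RHS]xx0; ring.
  by rewrite mulf_eq0 (negbTE two0).
have := dbl (m * l); rewrite [X in _ + X]mulrC => /(_ h3)/eqP.
have := dbl (n * m); rewrite [X in _ + X]mulrC => /(_ h1)/eqP.
rewrite !mulf_eq0 orbC; have [m0 _ _|_ /=] := eqVneq m 0.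
  by rewrite -Ea -Ec m0; ring.
move=> /eqP n0 /eqP l0; move: ac0.
by rewrite -Ea -Ec n0 l0 mul0r eqxx.
Qed.

(** * Irreducibility through a substitution that preserves the degree *)

Lemma size_mmap_le (n : nat) (A B : idomainType) (f : {rmorphism A -> B})
    (h : 'I_n -> {poly B}) (p : {mpoly A[n]}) :
  (forall i, (size (h i) <= 2)%N) ->
  (size (mmap (polyC \o f) h p) <= msize p)%N.
Proof.
move=> h2; rewrite /mmap big_seq.
apply: (leq_trans (size_sum _ _ _)).
apply/bigmax_leqP_seq => m mp _.
apply: leq_trans (msize_mdeg_lt mp).
rewrite /= mul_polyC; apply: leq_trans (size_scale_leq _ _) _.
rewrite /mmap1 mdegE.
elim/big_rec2: _ => [|i s q _ IH]; first by rewrite size_poly1.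
apply: leq_trans (size_polyMleq _ _) _.
have hX k : (size (h i ^+ k) <= k.+1)%N.
  apply: leq_trans (size_poly_exp_leq _ _) _.
  by rewrite ltnS -[leqRHS]mul1n leq_mul2r -subn1 leq_subLR h2 orbT.
by rewrite -subn1 leq_subLR add1n -addnS -addSn leq_add.
Qed.

Lemma mpoly_unit_msize_le1 (n : nat) (K : fieldType) (q : {mpoly K[n]}) :
  q != 0 -> (msize q <= 1)%N -> q \is a GRing.unit.
Proof.
move=> q0 /msize1_polyC qE.
have c0 : q@_0 != 0 by apply: contraNneq q0 => c0; rewrite qE c0 mpolyC0 eqxx.
rewrite qE; apply/unitrP; exists (q@_0)^-1%:MP.
by rewrite -!mpolyCM mulVf ?mulfV.
Qed.

Lemma unit_msize_le1 (n : nat) (K : idomainType) (q : {mpoly K[n]}) :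
  q \is a GRing.unit -> (msize q <= 1)%N.
Proof.
move=> /unitrP[p [pq _]].
have [q0 p0] : q != 0 /\ p != 0.
  by apply/andP; rewrite -negb_or orbC -mulf_eq0 pq oner_eq0.
have := msizeM p0 q0; rewrite pq msize1.
have : (0 < msize p)%N by rewrite lt0n msize_poly_eq0.
by case: (msize p) => // k _; rewrite addSn /= => ->; rewrite leq_addl.
Qed.

(** Sizes add up, with the same shift, on both sides of
    psi (q * r) = psi q * psi r. As psi does not lower the degree of F = q * r
    and does not raise those of q and r, it keeps both of these, so a factor
    with constant image is constant. *)
Lemma irreducible_of_specialization (n : nat) (K : fieldType) (B : idomainType)
    (f : {rmorphism K -> B}) (h : 'I_n -> {poly B}) (F : {mpoly K[n]}) :
  (forall i, (size (h i) <= 2)%N) ->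
  (1 < size (mmap (polyC \o f) h F))%N ->
  (msize F <= size (mmap (polyC \o f) h F))%N ->
  (forall q r, mmap (polyC \o f) h F = q * r ->
     (size q <= 1)%N \/ (size r <= 1)%N) ->
  irreducible F.
Proof.
move=> h2 psiF1 Fs irr; have F1 := leq_trans psiF1 (size_mmap_le f F h2).
set psi := mmap _ h in psiF1 Fs irr.
have F0 : F != 0 by rewrite -msize_poly_eq0; case: (msize F) F1.
split=> //; first by apply: contraL F1 => /unit_msize_le1; rewrite leqNgt.
move=> q r Fqr.
have [q0 r0] : q != 0 /\ r != 0 by apply/andP; rewrite -negb_or -mulf_eq0 -Fqr.
have psiM : psi F = psi q * psi r by rewrite Fqr /psi rmorphM.
have : psi F != 0 by rewrite -size_poly_gt0 ltnW.
rewrite psiM mulf_eq0 negb_or => /andP[pq0 pr0].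
move: Fs; rewrite psiM size_mul // Fqr msizeM //.
have := size_mmap_le f q h2; have := size_mmap_le f r h2.
rewrite -/psi; have := irr _ _ psiM.
move: (mpoly_unit_msize_le1 q0) (mpoly_unit_msize_le1 r0).
move: pq0 pr0 q0 r0; rewrite -!size_poly_gt0 -!msize_poly_eq0 -!lt0n.
case: (size (psi q)) => // i _; case: (size (psi r)) => // j _.
case: (msize q) => // k; case: (msize r) => // l _ _.
rewrite !addSn /= !addnS !ltnS !leqn0 => uq ur irr' jl ik kl.
have ij : i = k /\ j = l.
  have : (i + j == k + l)%N by rewrite eqn_leq kl leq_add.
  move=> /eqP E; split; apply/eqP; rewrite eqn_leq ?ik ?jl /=.
    by rewrite -(leq_add2r l) -E leq_add2l.
  by rewrite -(leq_add2l k) -E leq_add2r.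
by case: ij => ? ?; subst; case: irr' => [/uq|/ur]; [left|right].
Qed.

(** * Symmetric quartic forms in four variables *)

Lemma mmap_mesym (n k : nat) (A B : comNzRingType) (f : {rmorphism A -> B})
    (h : 'I_n -> B) :
  mmap f h (mesym n A k) = (mesym n B k).@[h].
Proof.
rewrite /mesym !raddf_sum /=; apply: eq_bigr => i _.
rewrite !rmorph_prod /=; apply: eq_bigr => j _.
by rewrite mmapX mmap1U mevalXU.
Qed.

Lemma meval_mesym42 (B : idomainType) (a b c d : B) :
  (mesym 4 B 2).@[tnth [tuple a; b; c; d]] =
  a * b + a * c + a * d + b * c + b * d + c * d.
Proof.
have := mroots_coeff [tuple a; b; c; d] (inord 2).
rewrite inordK // sqrrN expr1n mul1r => <-.
rewrite /= !big_cons big_nil.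
set s := RHS.
have -> : ('X - a%:P) * (('X - b%:P) * (('X - c%:P) * (('X - d%:P) * 1))) =
  'X^4 - (a + b + c + d)%:P * 'X^3 + s%:P * 'X^2
  - (a * b * c + a * b * d + a * c * d + b * c * d)%:P * 'X
  + (a * b * c * d)%:P.
  by rewrite /s; ring.
rewrite !(coefD, coefB, coefN, coefCM, coefXn, coefX, coefC) /= /s.
ring.
Qed.

Lemma irreducible_quartic_form (K : fieldType) (al be : K) (G : {mpoly K[4]}) :
  (2 : K) != 0 -> al != 0 -> be != 0 -> be + 12 * al != 0 ->
  G \is 3.-homog ->
  irreducible
    (mesym 4 K 1 * G + al%:MP * mesym 4 K 2 ^+ 2 - be%:MP * mesym 4 K 4).
Proof.
move=> two0 al0 be0 beal Gh; set F := (X in irreducible X).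
(* The four substituted values add up to 0, so that s1 * G disappears; the
   pairs u - 1, - u - 1 and 1 + v, 1 - v have elementary symmetric functions
   -2, 1 - u^2 and 2, 1 - v^2, whence the evenness in u and v. *)
pose u : {poly {poly K}} := 'X; pose v : {poly {poly K}} := 'X%:P.
pose h := tnth [tuple u - 1; 1 + v; 1 - v; - u - 1].
pose b := ((2 * al - be)%:P * 'X^2 + (4 * al + be)%:P : {poly K}).
pose c :=
  (al%:P * 'X^4 + (4 * al + be)%:P * 'X^2 + (4 * al - be)%:P : {poly K}).
have psiF :
    mmap (polyC \o polyC) h F = (al%:P)%:P * 'X^4 + b%:P * 'X^2 + c%:P.
  rewrite /F raddfB raddfD /= !rmorphM /= !mmapC.
  rewrite !mmap_mesym mesym1E mesymnnE meval_mesym42.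
  rewrite raddf_sum rmorph_prod /= !big_ord_recr !big_ord0 /=.
  rewrite !mevalXU /h !(tnth_nth 0) /= /b /c /u /v.
  ring.
have F5 : (msize F <= 5)%N.
  have Fh : F \is 4.-homog.
    have e k : mesym 4 K k \is k.-homog by apply: dhomog_mesym.
    rewrite /F !mul_mpolyC !(dhomogD, dhomogN) //.
    - exact: (dhomogM (e 1%N)).
    - exact/dhomogZ/(dhomogMn 2 (e 2%N)).
    - exact/dhomogZ.
  rewrite msizeE; apply/bigmax_leqP_seq => m mF _.
  by rewrite ltnS (dhomog_mf Fh mF).
have alP0 : al%:P != 0 :> {poly K} by rewrite polyC_eq0.
apply: (@irreducible_of_specialization 4 K _ polyC h).
- move=> i; apply/leq_sizeP => j j2; rewrite /h /u /v.
  case: i => -[|[|[|[|//]]]] i; rewrite (tnth_nth 0) /=;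
    rewrite !(coefD, coefB, coefN, coefX, coefC, coef1);
    by case: j j2 => [|[|j]] //= _; rewrite ?mulr0n ?(addr0, subr0, oppr0).
- by rewrite psiF size_biquadratic.
- by rewrite psiF size_biquadratic.
rewrite psiF => q r Eqr.
have [//|q1] := leqP (size q) 1; first by left.
have [//|r1] := leqP (size r) 1; first by right.
have [e [De|De]] := biquadratic_factor alP0 Eqr q1 r1.
  have {}De : e ^+ 2 = (be * (be - 4 * al))%:P * 'X^4
      + (- (2 * be * (4 * al + be)))%:P * 'X^2 + (be * (be + 12 * al))%:P.
    by rewrite De /b /c; ring.
  (* The coefficient of 'X^4 vanishes when be = 4 al, as it does for g; the
     constant one does not. *)
  have := sqr_biquadratic two0 _ De; rewrite (mulf_neq0 be0 beal) orbT.
  have nz : 2 ^+ 8 * be ^+ 2 * al ^+ 2 != 0 by rewrite !mulf_neq0 ?expf_neq0.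
  move=> /(_ isT)/eqP; rewrite -subr_eq0.
  have -> : (- (2 * be * (4 * al + be))) ^+ 2
      - 4 * (be * (be - 4 * al)) * (be * (be + 12 * al))
    = 2 ^+ 8 * be ^+ 2 * al ^+ 2 by ring.
  by rewrite (negbTE nz).
have {}De : e ^+ 2 = (al * al)%:P * 'X^4 + (al * (4 * al + be))%:P * 'X^2
    + (al * (4 * al - be))%:P.
  by rewrite De /c; ring.
have := sqr_biquadratic two0 _ De; rewrite (mulf_neq0 al0 al0).
have nz : al ^+ 2 * be * (be + 12 * al) != 0.
  by rewrite !mulf_neq0 ?expf_neq0.
move=> /(_ isT)/eqP; rewrite -subr_eq0.
have -> : (al * (4 * al + be)) ^+ 2 - 4 * (al * al) * (al * (4 * al - be))
  = al ^+ 2 * be * (be + 12 * al) by ring.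
by rewrite (negbTE nz).
Qed.

Lemma irreducible_real_symmetric_quartic (R : rcfType)
    (k x1 x2 x3 al be : R) :
  k != 0 -> al != 0 -> be != 0 -> be + 12 * al != 0 ->
  let C (x : R) := (x%:C)%C%:MP_[4] in let s := mesym 4 R[i]%C in
  irreducible (C k * (C x1 * s 1%N ^+ 4 + C x2 * s 1%N ^+ 2 * s 2%N
    + C al * s 2%N ^+ 2 + C x3 * s 1%N * s 3%N - C be * s 4%N)).
Proof.
move=> k0 al0 be0 beal C s.
pose G := C k * (C x1 * s 1%N ^+ 3 + C x2 * (s 1%N * s 2%N) + C x3 * s 3%N).
have Gh : G \is 3.-homog.
  have e j : s j \is j.-homog by apply: dhomog_mesym.
  rewrite /G /C !mul_mpolyC dhomogZ // !dhomogD ?dhomogZ //.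
    exact: (dhomogMn 3 (e 1%N)).
  exact: (dhomogM (e 1%N) (e 2%N)).
have -> : C k * (C x1 * s 1%N ^+ 4 + C x2 * s 1%N ^+ 2 * s 2%N
    + C al * s 2%N ^+ 2 + C x3 * s 1%N * s 3%N - C be * s 4%N)
  = s 1%N * G + (k * al)%:C%C%:MP * s 2%N ^+ 2 - (k * be)%:C%C%:MP * s 4%N.
  by rewrite /G /C !rmorphM /=; ring.
apply: irreducible_quartic_form => //.
- by rewrite pnatr_eq0.
- by rewrite fmorph_eq0 mulf_neq0.
- by rewrite fmorph_eq0 mulf_neq0.
- have -> : (k * be)%:C%C + 12 * (k * al)%:C%C = (k * (be + 12 * al))%:C%C.
    by rewrite !(rmorphM, rmorphD) /=; ring.
  by rewrite fmorph_eq0 mulf_neq0.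
Qed.

(** The three values of be + 12 al are 16 (t + 3) ^ 2, 16 (t + 3) ^ 2 and
    48 (t + 3) ^ 2. The ranges of t keep the other two coefficients away from
    their zeros: al vanishes at t = -1 for f_ab and at t = -7 for f_c, and be
    at t = 1 and t = - 13 / 3 for f_c. *)
Theorem proposition1p7 (R : realType) (t : R) :
  [/\ t != -3 -> irreducible (g t),
      0 <= t <= 5 -> irreducible (f_ab t) &
      5 < t -> irreducible (f_c t)].
Proof.
split.
- move=> t3.
  have a0 : (t + 3) ^+ 2 != 0 by rewrite expf_neq0 // addr_eq0.
  have := @irreducible_real_symmetric_quartic R 3^-1 3 (- (2 * (t + 7)))
    (- (2 * (t ^+ 2 - 9))) ((t + 3) ^+ 2) (4 * (t + 3) ^+ 2).
  rewrite /= /g !(rmorphN, mulNr).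
  apply=> //; rewrite ?invr_eq0 ?pnatr_eq0 //.
    by rewrite mulf_neq0 ?pnatr_eq0.
  by rewrite -mulrDl -natrD mulf_neq0 ?pnatr_eq0.
- move=> /andP[t0 _].
  have := @irreducible_real_symmetric_quartic R 3^-1 3 (- (2 * (t + 7)))
    (t ^+ 2 - 6 * t + 21) (8 * (t + 1)) (16 * (t ^+ 2 + 3)).
  rewrite /= /f_ab !(rmorphN, mulNr).
  apply; rewrite ?invr_eq0 ?pnatr_eq0 //; apply: lt0r_neq0; nra.
- move=> t5.
  have := @irreducible_real_symmetric_quartic R 9^-1 9 (- (6 * (t + 7)))
    (12 * (t - 1)) ((t + 7) ^+ 2) (12 * (t - 1) * (3 * t + 13)).
  rewrite /= /f_c !(rmorphN, mulNr).
  apply; rewrite ?invr_eq0 ?pnatr_eq0 //; apply: lt0r_neq0; nra.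
Qed.
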